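(* Let $\mathcal{X},\mathcal{Y}$ be Banach spaces, $\mathcal{A}:\mathcal{X}\to\mathcal{Y}$ a bounded linear operator, $\mathcal{R}:\mathcal{X}\to[0,\infty)$ and $\mathcal{D}:\mathcal{Y}\times\mathcal{Y}\to[0,\infty)$, and for $\alpha>0$, $y\in\mathcal{Y}$ let $\mathcal{J}_{\alpha,y}(x)=\alpha\mathcal{R}(x)+\mathcal{D}(\mathcal{A}x,y)$. Assume: (1) $\mathcal{X}$ is reflexive; (2) $\mathcal{R}$ is weakly sequentially lower semicontinuous; (3) $\mathcal{R}=R_{wc}+R_{sc}$, where $R_{wc}:\mathcal{X}\to[0,\infty)$ is $\gamma$-weakly convex, $R_{sc}$ is $\mu$-strongly convex, and either (a) $\gamma\le\mu$, or (b) $\mu<\gamma<2\mu$ and $R_{sc}-\frac{\mu}{2}\|\cdot\|_{\mathcal{X}}^2$ is weakly sequentially lower semicontinuous; (4) $\mathcal{D}$ is weakly sequentially lower semicontinuous, convex in its first argument, continuous in its second argument, and $\mathcal{D}(y_1,y_2)=0$ if and only if $y_1=y_2$; (5) there exist $C>0$ and $p\ge1$ such that for all $y_1,y_2,y_3\in\mathcal{Y}$, $\mathcal{D}(y_1,y_2)\le C(\mathcal{D}(y_1,y_3)+\|y_2-y_3\|_{\mathcal{Y}}^p)$. Then for all $\alpha>0$ and $y^\delta\in\mathcal{Y}$, the set of critical points of $\mathcal{J}_{\alpha,y^\delta}$ is non-empty.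
   Context: A function $f$ is $\rho$-convex if $f-\frac{\rho}{2}\|\cdot\|^2$ is convex; $\mu$-strongly convex means $\mu$-convex with $\mu>0$; $\gamma$-weakly convex ($\gamma\ge0$) means $f+\frac{\gamma}{2}\|\cdot\|^2$ is convex. The (Fréchet) subdifferential of $f:\mathcal{X}\to\mathbb{R}\cup\{\infty\}$ at $x$ with $f(x)<\infty$ is $\partial f(x)=\{\psi\in\mathcal{X}^*: f(x')\ge f(x)+\psi(x'-x)+o(\|x'-x\|)\text{ as }x'\to x\}$ (empty if $f(x)=\infty$); a critical point is a point $x$ with $0\in\partial f(x)$. *)

(* Defs.v *)
From HB Require Import structures.
From mathcomp Require Import all_boot all_order all_algebra.
From mathcomp Require Import all_classical all_reals all_analysis.
Set Implicit Arguments. Unset Strict Implicit. Unset Printing Implicit Defensive.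
Import Order.TTheory GRing.Theory Num.Theory.
Import numFieldNormedType.Exports.
Local Open Scope classical_set_scope.
Local Open Scope ring_scope.

Section Defs.
Context {R : realType}.

Definition dual_vec {X : normedModType R} (psi : X -> R) : Prop :=
  (forall (a : R) (u v : X), psi (a *: u + v) = a * psi u + psi v) /\
  continuous psi.

Definition weak_cvg {X : normedModType R} (u : nat -> X) (x : X) : Prop :=
  forall psi : X -> R, dual_vec psi -> (fun n => psi (u n)) @ \oo --> psi x.

Definition wslsc {X : normedModType R} (f : X -> R) : Prop :=
  forall (u : nat -> X) (x : X), weak_cvg u x ->
    ((f x)%:E <= limn_einf (fun n => (f (u n))%:E))%E.

(* weak sequential lsc on a product Y x Y (weak topology of Y x Y:
   componentwise weak convergence, since the dual of Y x Y is the product of the duals) *)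
Definition wslsc2 {Y : normedModType R} (D : Y -> Y -> R) : Prop :=
  forall (u v : nat -> Y) (y1 y2 : Y), weak_cvg u y1 -> weak_cvg v y2 ->
    ((D y1 y2)%:E <= limn_einf (fun n => (D (u n) (v n))%:E))%E.

(* reflexivity: the canonical embedding of X into its bidual is onto, the bidual being the
   space of bounded linear functionals on the dual of X (with its operator norm) *)
Definition reflexive_space (X : normedModType R) : Prop :=
  forall Phi : (X -> R) -> R,
    (forall (a : R) (psi1 psi2 : X -> R), dual_vec psi1 -> dual_vec psi2 ->
       Phi (fun x => a * psi1 x + psi2 x) = a * Phi psi1 + Phi psi2) ->
    (exists M : R, forall (psi : X -> R) (K : R), dual_vec psi -> 0 <= K ->
       (forall x, `|psi x| <= K * `|x|) -> `|Phi psi| <= M * K) ->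
    exists x : X, forall psi : X -> R, dual_vec psi -> Phi psi = psi x.

Definition convex_fun {X : normedModType R} (f : X -> R) : Prop :=
  forall (x y : X) (t : R), 0 <= t <= 1 ->
    f (t *: x + (1 - t) *: y) <= t * f x + (1 - t) * f y.

Definition rho_convex {X : normedModType R} (rho : R) (f : X -> R) : Prop :=
  convex_fun (fun x => f x - rho / 2 * `|x| ^+ 2).

Definition strongly_convex {X : normedModType R} (mu : R) (f : X -> R) : Prop :=
  0 < mu /\ rho_convex mu f.

Definition weakly_convex {X : normedModType R} (gamma : R) (f : X -> R) : Prop :=
  0 <= gamma /\ convex_fun (fun x => f x + gamma / 2 * `|x| ^+ 2).

Definition frechet_subgrad {X : normedModType R} (f : X -> R) (x : X)
    (psi : X -> R) : Prop :=
  dual_vec psi /\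
  forall eps : R, 0 < eps ->
    \forall x' \near x, f x + psi (x' - x) - eps * `|x' - x| <= f x'.

Definition critical_point {X : normedModType R} (f : X -> R) (x : X) : Prop :=
  frechet_subgrad f x (fun _ => 0).

End Defs.

(* Main.v *)
Require Import Defs.
From HB Require Import structures.
From mathcomp Require Import all_boot all_order all_algebra.
From mathcomp Require Import all_classical all_reals all_analysis.
From mathcomp Require Import ring lra.
Import Order.TTheory GRing.Theory Num.Theory.
Import numFieldNormedType.Exports.
Local Open Scope classical_set_scope.
Local Open Scope ring_scope.

(* The functional J = alpha Rg + D(A -, ydelta) has a global minimiser, and a
   global minimiser is critical.
   - Coercivity: Rg is lower semicontinuous and finite, so by Baire it is bounded
     above on some ball; so is the smaller convex function
     Rsc - (mu/2)|.|^2 <= Rsc <= Rg, which therefore decreases at most linearly,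
     and Rsc (hence Rg) grows quadratically.
   - Compactness: bounded sequences of a reflexive space have weakly convergent
     subsequences. *)

(** * Sublinear functionals and Hahn-Banach *)

Section HahnBanach.
Context {R : realType} {V : lmodType R}.
Implicit Types (p q : V -> R) (x y : V).

Definition sublinear q : Prop :=
  (forall u v, q (u + v) <= q u + q v) /\
  (forall (a : R) u, 0 <= a -> q (a *: u) = a * q u).

Lemma sublinear0 q : sublinear q -> q 0 = 0.
Proof. by case=> _ qZ; rewrite -(scale0r 0) qZ // mul0r. Qed.

Lemma sublinear_ge q x : sublinear q -> - q (- x) <= q x.
Proof.
move=> qs; have := qs.1 x (- x); rewrite subrr sublinear0 //.
by rewrite -lerBlDr sub0r.
Qed.

(** Applying the inequality to [a^-1] and [a *: u] gives its converse, so infima only need the easy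
    bound. *)
Lemma sublinear_homo q :
  (forall u v, q (u + v) <= q u + q v) -> q 0 = 0 ->
  (forall (a : R) u, 0 < a -> q (a *: u) <= a * q u) -> sublinear q.
Proof.
move=> qD q0 qZ; split=> // a u; rewrite le_eqVlt => /predU1P[<-|a0].
  by rewrite scale0r q0 mul0r.
apply/eqP; rewrite eq_le qZ //= -ler_pdivlMl //.
have := qZ a^-1 (a *: u); rewrite invr_gt0 => /(_ a0).
by rewrite scalerA mulVf ?gt_eqF // scale1r.
Qed.

(* The functional [y |-> inf_(t >= 0) (q (y + t x) - t q x)] works. *)
Lemma sublinear_descent q x : sublinear q ->
  exists q', [/\ sublinear q', forall y, q' y <= q y & q' (- x) <= - q x].
Proof.
move=> qs; have [qD qZ] := qs.
pose F y (t : R) := q (y + t *: x) - t * q x.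
pose S y := [set F y t | t in [set t | 0 <= t]].
(* Subadditivity on [t *: x = (y + t *: x) + (- y)]; this keeps the infimum finite. *)
have lbF y t : 0 <= t -> - q (- y) <= F y t.
  move=> t0; have := qD (y + t *: x) (- y).
  by rewrite addrAC subrr add0r qZ // /F; lra.
have lbS y : has_lbound (S y).
  by exists (- q (- y)) => _ [t t0 <-]; exact: lbF.
have neS y : S y !=set0 by exists (F y 0); exists 0 => /=.
have infS y t : 0 <= t -> inf (S y) <= F y t.
  by move=> t0; apply: ge_inf => //; exists t.
have leq y : inf (S y) <= q y.
  by apply: le_trans (infS y 0 _) _ => //; rewrite /F scale0r addr0 mul0r subr0.
exists (fun y => inf (S y)); split => //; last first.
  apply: le_trans (infS (- x) 1 ler01) _.
  by rewrite /F scale1r addNr sublinear0 // sub0r mul1r.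
apply: sublinear_homo.
- move=> u v.
  rewrite -lerBlDr; apply: lb_le_inf => // _ [s s0 <-]; rewrite lerBlDr.
  rewrite -lerBlDl; apply: lb_le_inf => // _ [t t0 <-]; rewrite lerBlDl.
  apply: le_trans (infS _ (s + t) (addr_ge0 s0 t0)) _; rewrite /F.
  have := qD (u + s *: x) (v + t *: x).
  by rewrite addrACA -scalerDl mulrDl; lra.
- apply/eqP; rewrite eq_le; apply/andP; split.
    by have := leq 0; rewrite sublinear0.
  apply: lb_le_inf => // _ [t t0 <-]; apply: le_trans (lbF _ _ t0).
  by rewrite oppr0 sublinear0 // oppr0.
- move=> a u a0; rewrite -ler_pdivrMl //; apply: lb_le_inf => // _ [t t0 <-].
  rewrite ler_pdivrMl //; apply: le_trans (infS _ (a * t) _) _.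
    by rewrite mulr_ge0 // ltW.
  by rewrite /F -scalerA -scalerDr (qZ _ _ (ltW a0)) mulrBr mulrA.
Qed.

(** Supplies the bounds of chains for Zorn. The pointwise infimum is subadditive because, of two
    members nearly optimal at [u] and at [v], the smaller one serves at both. *)
Lemma sublinear_chain_inf p (A : set (V -> R)) : A !=set0 ->
  (forall q, A q -> sublinear q /\ forall y, q y <= p y) ->
  total_on A (fun q q' => forall y, q' y <= q y) ->
  exists q, [/\ sublinear q, forall y, q y <= p y &
    forall q', A q' -> forall y, q y <= q' y].
Proof.
move=> [q0 Aq0] Ap Atot; pose S y := [set q y | q in A].
have lbS y : has_lbound (S y).
  exists (- p (- y)) => _ [q Aq <-]; have [qs qp] := Ap q Aq.
  by apply: le_trans (sublinear_ge q y qs); rewrite lerN2.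
have neS y : S y !=set0 by exists (q0 y); exists q0.
have infS q y : A q -> inf (S y) <= q y by move=> Aq; apply: ge_inf => //; exists q.
exists (fun y => inf (S y)); split; last 2 first.
- by move=> y; apply: le_trans (infS q0 y Aq0) _; apply: (Ap _ Aq0).2.
- by move=> q' Aq' y; exact: infS.
apply: sublinear_homo.
- move=> u v.
  rewrite -lerBlDr; apply: lb_le_inf => // _ [q Aq <-]; rewrite lerBlDr.
  rewrite -lerBlDl; apply: lb_le_inf => // _ [q' Aq' <-]; rewrite lerBlDl.
  have [qs qp] := Ap q Aq; have [qs' qp'] := Ap q' Aq'.
  have [le|le] := Atot _ _ Aq Aq'.
    have := infS q' (u + v) Aq'; have := qs'.1 u v; have := le u; lra.
  have := infS q (u + v) Aq; have := qs.1 u v; have := le v; lra.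
- apply/eqP; rewrite eq_le; apply/andP; split.
    by have := infS q0 0 Aq0; rewrite sublinear0 //; exact: (Ap _ Aq0).1.
  by apply: lb_le_inf => // _ [q Aq <-]; rewrite sublinear0 //; exact: (Ap _ Aq).1.
- move=> a u a0; rewrite -ler_pdivrMl //; apply: lb_le_inf => // _ [q Aq <-].
  rewrite ler_pdivrMl // -((Ap _ Aq).1.2 _ _ (ltW a0)); exact: infS.
Qed.

(* A minimal sublinear functional [q] is linear: by [sublinear_descent] it is odd. *)
Lemma hahn_banach p x : sublinear p ->
  exists f : V -> R, [/\ forall (a : R) u v, f (a *: u + v) = a * f u + f v,
    forall y, f y <= p y & f x = p x].
Proof.
move=> ps; have [p' [ps' pp' p'x]] := sublinear_descent p x ps.
pose T := {q : V -> R | sublinear q /\ forall y, q y <= p' y}.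
(* The order is reversed, so that Zorn's maximal element is a minimal functional. *)
pose rT (s t : T) : bool := `[< forall y, sval t y <= sval s y >].
have t0 : T by exists p'.
have [| | |[q [qs qp]] qmin] := @ZL_preorder T t0 rT.
- by move=> t; apply/asboolP.
- move=> r s t /asboolP rs /asboolP st; apply/asboolP => y.
  exact: le_trans (st y) (rs y).
- move=> A Atot; have [[a0 Aa0]|A0] := pselect (A !=set0); last first.
    by exists t0 => s As; exfalso; apply: A0; exists s.
  have [||| q [qs qp qA]] := @sublinear_chain_inf p' [set sval a | a in A].
  + by exists (sval a0); exists a0.
  + by move=> _ [a Aa <-]; exact: (svalP a).
  + move=> _ _ [a Aa <-] [b Ab <-].
    by have [/asboolP|/asboolP] := Atot _ _ Aa Ab; [left|right].
  exists (exist _ q (conj qs qp)) => s As; apply/asboolP => y /=.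
  by apply: qA; exists s.
have qN u : q (- u) = - q u.
  have [q' [qs' q'q q'u]] := sublinear_descent q u qs.
  have q'p y : q' y <= p' y by exact: le_trans (q'q y) (qp y).
  have := qmin (exist _ q' (conj qs' q'p)).
  have -> : rT (exist _ q (conj qs qp)) (exist _ q' (conj qs' q'p)).
    by apply/asboolP => y /=.
  move=> /(_ isT)/asboolP /= /(_ (- u)) qq'.
  have := sublinear_ge q u qs; lra.
have qD u v : q (u + v) = q u + q v.
  have := qs.1 u v; have := qs.1 (u + v) (- v); rewrite addrK qN; lra.
exists q; split.
- move=> a u v; rewrite qD; congr (_ + _).
  have [a0|a0] := leP 0 a; first exact: qs.2.
  rewrite -[a]opprK scaleNr qN qs.2 ?mulNr // oppr_ge0; exact: ltW.
- by move=> y; exact: le_trans (qp y) (pp' y).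
- have := le_trans (qp (- x)) p'x; rewrite qN lerN2 => px.
  by apply/eqP; rewrite eq_le px (le_trans (qp x) (pp' x)).
Qed.

End HahnBanach.

(** * Continuous functionals, annihilators and linear spans *)

Section Duality.
Context {R : realType} {X : normedModType R}.
Implicit Types (psi : X -> R) (x y : X) (E : set X).

Lemma dual_vecB psi x y : dual_vec psi -> psi (x - y) = psi x - psi y.
Proof.
by case=> psiL _; rewrite addrC -scaleN1r psiL mulN1r addrC.
Qed.

Lemma dual_vec0 psi : dual_vec psi -> psi 0 = 0.
Proof. by move=> /(dual_vecB psi 0 0); rewrite !subrr. Qed.

Lemma dual_vecZ psi (a : R) x : dual_vec psi -> psi (a *: x) = a * psi x.
Proof. by move=> pd; rewrite -[a *: x]addr0 pd.1 dual_vec0 // addr0. Qed.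

Lemma dual_vec_le_norm psi :
  (forall (a : R) u v, psi (a *: u + v) = a * psi u + psi v) ->
  (forall y, psi y <= `|y|) -> dual_vec psi /\ forall y, `|psi y| <= `|y|.
Proof.
move=> psiL psi_le.
have psiB u v : psi (u - v) = psi u - psi v.
  by rewrite addrC -scaleN1r psiL mulN1r addrC.
have psi_norm y : `|psi y| <= `|y|.
  have := psi_le (0 - y); rewrite psiB sub0r normrN.
  have -> : psi 0 = 0 by rewrite -(subrr (0 : X)) psiB subrr.
  by rewrite ler_norml psi_le andbT sub0r lerNl.
split=> //; split=> // x.
apply/cvgrPdist_lt => e e0; near=> y.
rewrite -psiB; apply: le_lt_trans (psi_norm _) _.
by near: y; apply: cvgr_dist_lt.
Unshelve. all: by end_near. Qed.

Lemma dual_vec_bounded psi : dual_vec psi ->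
  exists2 K : R, 0 <= K & forall x, `|psi x| <= K * `|x|.
Proof.
move=> pd; have [_ /(_ 0)] := pd; rewrite /continuous_at dual_vec0 //.
move=> /cvgrPdist_lt /(_ 1 ltr01) /nbhs_ballP[r /= r0 rP].
exists (2 / r); first by rewrite divr_ge0 // ltW.
move=> x; have [->|x0] := eqVneq x 0; first by rewrite dual_vec0 // !normr0 mulr0.
have nx : 0 < `|x| by rewrite normr_gt0.
(* Rescaling [x] to norm [r / 2] puts it in the ball where [psi] is below 1 in absolute value,
   whence the constant [2 / r]. *)
have c0 : 0 < r / 2 / `|x| by rewrite !divr_gt0.
have : ball 0 r ((r / 2 / `|x|) *: x).
  rewrite -ball_normE /= sub0r normrN normrZ gtr0_norm // mulfVK ?gt_eqF //.
  lra.
move=> /rP; rewrite /= sub0r normrN dual_vecZ // normrM gtr0_norm //.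
rewrite -ltr_pdivlMl // => /ltW /le_trans; apply.
by rewrite mulr1 !invf_div mulrC.
Qed.

Lemma norming_functional x : exists psi,
  [/\ dual_vec psi, forall y, `|psi y| <= `|y| & psi x = `|x|].
Proof.
have [|f [fL fle fx]] := @hahn_banach R X (fun y => `|y|) x.
  split=> [u v|a u a0]; first exact: ler_normD.
  by rewrite normrZ ger0_norm.
by have [fd fn] := dual_vec_le_norm f fL fle; exists f.
Qed.

(* Hahn-Banach applied to the seminorm [dist(-, E)]. *)
Lemma annihilated_approx E x : E 0 ->
  (forall (a : R) u v, E u -> E v -> E (a *: u + v)) ->
  (forall psi, dual_vec psi -> (forall e, E e -> psi e = 0) -> psi x = 0) ->
  forall eps : R, 0 < eps -> exists2 e, E e & `|x - e| < eps.
Proof.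
move=> E0 EL Ex eps eps0.
pose S y := [set `|y - e| | e in E].
have lbS y : has_lbound (S y) by exists 0 => _ [e _ <-].
have neS y : S y !=set0 by exists `|y - 0|; exists 0.
have infS y e : E e -> inf (S y) <= `|y - e|.
  by move=> Ee; apply: ge_inf => //; exists e.
have inf_ge0 y : 0 <= inf (S y) by apply: lb_le_inf => // _ [e _ <-].
have EZ (a : R) e : E e -> E (a *: e) by move=> Ee; rewrite -[a *: e]addr0; exact: EL.
have dE e : E e -> inf (S e) = 0.
  move=> Ee; apply/eqP; rewrite eq_le inf_ge0 andbT.
  by apply: le_trans (infS e e Ee) _; rewrite subrr normr0.
have [|f [fL fle fx]] := @hahn_banach R X (fun y => inf (S y)) x.
  apply: sublinear_homo.
  - move=> u v.
    rewrite -lerBlDr; apply: lb_le_inf => // _ [d Ed <-]; rewrite lerBlDr.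
    rewrite -lerBlDl; apply: lb_le_inf => // _ [e Ee <-]; rewrite lerBlDl.
    apply: le_trans (infS _ (d + e) _) _.
      by rewrite -[d]scale1r; exact: EL.
    by rewrite opprD addrACA ler_normD.
  - exact: dE.
  - move=> a u a0; rewrite -ler_pdivrMl //; apply: lb_le_inf => // _ [e Ee <-].
    rewrite ler_pdivrMl //; apply: le_trans (infS _ (a *: e) (EZ _ _ Ee)) _.
    by rewrite -scalerBr normrZ gtr0_norm.
have [|fd _] := dual_vec_le_norm f fL.
  by move=> y; apply: le_trans (fle y) _; rewrite -[y in leRHS]subr0; exact: infS.
have fE e : E e -> f e = 0.
  move=> Ee; apply/eqP; rewrite eq_le -{1}(dE e Ee) fle /=.
  have := fle (-1 *: e); rewrite dE; last exact: EZ.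
  by rewrite dual_vecZ // mulN1r oppr_le0.
(* The distance from [x] to [E] equals [f x], which is 0 because [f] annihilates [E]. *)
have [|_ [e Ee <-]] := inf_adherent eps0 (_ : has_inf (S x)); first by split.
by rewrite -fx Ex // add0r; exists e.
Qed.

(** Coefficients form a list, so that the rational combinations are indexed by the countable type
    [seq rat]. *)
Fixpoint lincomb (s : seq R) (u : nat -> X) : X :=
  if s is a :: s' then a *: u 0%N + lincomb s' (fun n => u n.+1) else 0.

Lemma lincomb_linear (a : R) s t u :
  exists r, lincomb r u = a *: lincomb s u + lincomb t u.
Proof.
elim: s t u => [|b s IH] t u /=; first by exists t; rewrite scaler0 add0r.
(* An exhausted list [t] is padded with a zero coefficient, to align it with [b :: s]. *)
have [t0 [t' tE]] : exists t0 t',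
    lincomb t u = t0 *: u 0%N + lincomb t' (fun n => u n.+1).
  case: t => [|t0 t'] /=; last by exists t0, t'.
  by exists 0, [::]; rewrite /= scale0r addr0.
have [r rE] := IH t' (fun n => u n.+1).
exists ((a * b + t0) :: r) => /=.
by rewrite rE tE scalerDr scalerA scalerDl addrACA.
Qed.

Lemma lincomb_term u n : exists s, lincomb s u = u n.
Proof.
elim: n u => [|n IH] u; first by exists [:: 1]; rewrite /= scale1r addr0.
have [s sE] := IH (fun n => u n.+1).
by exists (0 :: s); rewrite /= scale0r add0r.
Qed.

(** Half of the error goes to the head coefficient and half to the tail; the [+ 1] in the
    denominator covers [u 0 = 0]. *)
Lemma lincomb_rat_approx s u (eps : R) : 0 < eps ->
  exists t : seq rat, `|lincomb s u - lincomb (map ratr t) u| < eps.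
Proof.
elim: s u eps => [|a s IH] u eps eps0; first by exists [::]; rewrite subrr normr0.
have e20 : 0 < eps / 2 by rewrite divr_gt0.
have [t tP] := IH (fun n => u n.+1) _ e20.
have n0 : 0 < `|u 0%N| + 1 by rewrite ltr_wpDl.
have [|q] := @rat_in_itvoo R (a - eps / 2 / (`|u 0%N| + 1)) a.
  by rewrite ltrBlDr ltrDl divr_gt0.
rewrite in_itv /= => /andP[aq qa].
exists (q :: t) => /=.
rewrite opprD addrACA -scalerBl; apply: le_lt_trans (ler_normD _ _) _.
rewrite (splitr eps) ler_ltD // normrZ gtr0_norm ?subr_gt0 //.
apply: (@le_trans _ _ ((a - ratr q) * (`|u 0%N| + 1))).
  by rewrite ler_wpM2l ?lerDl // subr_ge0 ltW.
by rewrite -ler_pdivlMr // lerBlDr -lerBlDl ltW.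
Qed.

End Duality.

(** * Weak sequential compactness through ultrafilters *)

Section WeakCompactness.
Context {R : realType}.

(** Compactness of [[-B, B]] gives a cluster point, and an ultrafilter converges to each of its
    cluster points. *)
Lemma ultra_cvg_bounded (U : set_system nat) (f : nat -> R) (B : R) :
  UltraFilter U -> (forall n, `|f n| <= B) -> cvg (f @ U).
Proof.
move=> UU fB.
have [|p [_ pcl]] := @segment_compact R (- B) B (f @ U) _.
  by apply: (@filterE _ U) => n; rewrite /= in_itv /= -ler_norml.
apply/cvg_ex; exists p => N /= Np.
have [//|UN] := in_ultra_setVsetC (f @^-1` N) UU.
by have [x [/=]] := pcl (~` N) N UN Np.
Qed.

(** If convergence fails for some [e], the bad indices meet every eventual set, and an ultrafilter
    containing them refines [\oo] without converging to [l]. *)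
Lemma cvg_ultraP (f : nat -> R) (l : R) :
  (forall V, UltraFilter V -> \oo `<=` V -> f @ V --> l) -> f @ \oo --> l.
Proof.
move=> fV; apply/cvgrPdist_lt => e e0; apply/not_notP => nS.
pose S := [set n | ~ `|l - f n| < e].
have PS : ProperFilter (within S \oo).
  apply: Build_ProperFilter_ex => // A; rewrite /within /= => SA.
  apply/not_notP => A0; apply: nS; apply: filterS SA => n SAn.
  by apply/not_notP => /SAn An; apply: A0; exists n.
have [V [VU SV]] := ultraFilterLemma PS.
have ooV : \oo `<=` V.
  by move=> A ooA; apply: SV; apply: filterS ooA => n An _.
have VS : V S by apply: SV; exact: withinT.
have /cvgrPdist_lt /(_ e e0) Vl := fV V VU ooV.
by have [n [? ?]] := filter_ex (filterI VS Vl).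
Qed.

Lemma cvg_eq0 (W : set_system nat) (f : nat -> R) (l : R) :
  ProperFilter W -> (forall n, f n = 0) -> f @ W --> l -> l = 0.
Proof.
move=> WW f0; have -> : f = fun=> 0 by apply/funext.
by move=> /(cvg_lim (@Rhausdorff R)) <-; exact: (lim_cst (@Rhausdorff R)).
Qed.

Context {X : normedModType R} (Xrefl : reflexive_space X).

(** The limit of [psi (u n)] along [U] is linear in [psi] and bounded by [M]: it is an element of
    the bidual, which reflexivity represents by a point. *)
Lemma reflexive_ultra_weak_limit (U : set_system nat) (u : nat -> X) (M : R) :
  UltraFilter U -> (forall n, `|u n| <= M) ->
  exists x, forall psi, dual_vec psi -> psi \o u @ U --> psi x.
Proof.
move=> UU uM.
have psicvg psi : dual_vec psi -> cvg (psi \o u @ U).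
  move=> pd; have [K K0 psiK] := dual_vec_bounded psi pd.
  apply: (@ultra_cvg_bounded U _ (K * M)) => // n.
  by apply: le_trans (psiK _) _; rewrite ler_wpM2l.
have [| |x xP] := Xrefl (fun psi => lim (psi \o u @ U)).
- move=> a psi1 psi2 pd1 pd2; apply/cvg_lim => //.
  apply: cvgD; last exact: psicvg.
  by apply: cvgMr; exact: psicvg.
- exists M => psi K pd K0 psiK.
  have <- : lim ((fun n => `|psi (u n)|) @ U) = `|lim (psi \o u @ U)|.
    by apply/cvg_lim => //; apply: cvg_norm; exact: psicvg.
  apply: limr_le; first by apply: is_cvg_norm; exact: psicvg.
  apply: filterE => n /=; apply: le_trans (psiK _) _.
  by rewrite mulrC ler_wpM2r.
- by exists x => psi pd; rewrite -xP //; exact: psicvg.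
Qed.

(* [x] is a weak limit of [u] along an ultrafilter; norming functionals of the
   rational span of [u] separate the points of the closed span of [u], so a
   subsequence along which these countably many functionals converge to their
   value at [x] has no other ultrafilter limit. *)
Lemma reflexive_weak_seq_compact (u : nat -> X) (M : R) :
  (forall n, `|u n| <= M) ->
  exists (k : nat -> nat) (x : X),
    (forall j, (j <= k j)%N) /\ weak_cvg (u \o k) x.
Proof.
move=> uM.
have [U [UU ooU]] := ultraFilterLemma (_ : ProperFilter (\oo : set_system nat)).
have [x xP] := reflexive_ultra_weak_limit U u M UU uM.
(* Enumerates the rational span; codes that decode to nothing yield the zero vector. *)
pose q (i : nat) : X :=
  lincomb (map ratr (odflt [::] (unpickle i : option (seq rat)))) u.
have [psi psiP] := choice (fun i => norming_functional (q i)).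
pose P j i := [set n | `|psi i x - psi i (u n)| < j.+1%:R^-1].
have UP j m : U [set n | forall i, (i < m)%N -> P j i n].
  elim: m => [|m IH]; first exact: filterE.
  have /cvgrPdist_lt /(_ (j.+1%:R^-1)) := xP _ (let: And3 d _ _ := psiP m in d).
  rewrite invr_gt0 ltr0Sn => /(_ isT) Um.
  apply: filterS (filterI IH Um) => n [IHn Pn] i.
  by rewrite ltnS leq_eqVlt => /predU1P[->|/IHn].
(* Diagonal choice: [k j] meets the first [j] conditions with error [1 / (j + 1)]. Monotonicity of
   [k] is replaced by [j <= k j]. *)
have /choice[k kP] : forall j, exists n,
    (j <= n)%N /\ forall i, (i < j)%N -> P j i n.
  move=> j; have [n nP] := filter_ex (filterI (ooU _ (nbhs_infty_ge j)) (UP j j)).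
  by exists n.
exists k, x; split=> [j|phi phid]; first exact: (kP j).1.
apply: cvg_ultraP => V VU ooV.
have [y yP] := reflexive_ultra_weak_limit V (u \o k) M VU (fun n => uM (k n)).
suff -> : x = y by exact: yP.
have psixy i : psi i (x - y) = 0.
  have [pd _ _] := psiP i; rewrite dual_vecB //.
  have psix : psi i \o (u \o k) @ \oo --> psi i x.
    apply/cvgrPdist_lt => e e0; near=> j.
    apply: lt_trans ((kP j).2 i _) _; first by near: j; exact: nbhs_infty_gt.
    by near: j; exact: (near_infty_natSinv_lt (PosNum e0)).
  have psixV : psi i \o (u \o k) @ V --> psi i x by move=> A /psix /ooV.
  rewrite -(cvg_lim (@Rhausdorff R) psixV).
  by rewrite (cvg_lim (@Rhausdorff R) (yP _ pd)) subrr.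
(* Functionals vanishing on all [u n] vanish at the weak limits [x] and [y], so [x - y] is in the
   closed span. *)
have xyE (eps : R) : 0 < eps -> exists2 e, range (lincomb ^~ u) e & `|x - y - e| < eps.
  apply: annihilated_approx.
  - by exists [::].
  - move=> a _ _ [s _ <-] [t _ <-]; have [r rE] := lincomb_linear a s t u.
    by exists r.
  - move=> chi chid chiE.
    have chiu n : chi (u n) = 0.
      by have [s sE] := lincomb_term u n; apply: chiE; exists s.
    have chix : chi x = 0 by apply: cvg_eq0 (xP _ chid) => n; exact: chiu.
    have chiy : chi y = 0 by apply: cvg_eq0 (yP _ chid) => n; exact: chiu.
    by rewrite dual_vecB // chix chiy subrr.
(* Let [v = x - y] and let [q] be a rational combination within [eps / 2] of [v]. Its norming
   functional kills [v], so [|q| = psi (q - v) <= |q - v|], and [|v| <= 2 |q - v| < eps]. *)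
apply/eqP; rewrite -subr_eq0 -normr_le0; apply/ler_addgt0Pr => eps eps0.
have e40 : 0 < eps / 4 by rewrite divr_gt0.
have [_ [s _ <-] xys] := xyE _ e40.
have [t st] := lincomb_rat_approx s u (eps / 4) e40.
have qt : q (pickle t) = lincomb (map ratr t) u by rewrite /q pickleK.
have [pd ple pq] := psiP (pickle t).
have vq : `|x - y - q (pickle t)| < eps / 2.
  rewrite -(subrKA (lincomb s u)) qt; apply: le_lt_trans (ler_normD _ _) _.
  lra.
have := ple (q (pickle t) - (x - y)); rewrite dual_vecB // psixy subr0 pq normr_id.
have := ler_distD (q (pickle t)) (x - y) 0; rewrite !subr0.
rewrite [`|q _ - (x - y)|]distrC; lra.
Unshelve. all: by end_near. Qed.

End WeakCompactness.

(** * Lower semicontinuity, coercivity and the direct method *)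

Section LowerSemicontinuity.
Context {R : realType}.

(** The lower limit is the supremum of the tail infima, one of which must exceed [l - e]. *)
Lemma limn_einf_near (f : nat -> R) (l e : R) :
  (l%:E <= limn_einf (fun n => (f n)%:E))%E -> 0 < e ->
  \forall n \near \oo, l - e < f n.
Proof.
move=> lf e0; set g := fun n => _ in lf.
have supE : limn_einf g = ereal_sup (range (einfs g)).
  by rewrite limn_einf_lim; apply/cvg_lim => //; exact: cvg_einfs_sup.
have : ((l - e)%:E < ereal_sup (range (einfs g)))%E.
  by rewrite -supE; apply: lt_le_trans lf; rewrite lte_fin ltrBlDr ltrDl.
move=> /ereal_sup_gt[_ [m _ <-] lem]; exists m => // n /= mn.
rewrite -lte_fin; apply: lt_le_trans lem _.
by apply: ereal_inf_lbound; exists n.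
Qed.

Lemma cvg_weak_cvg {X : normedModType R} (u : nat -> X) (x : X) :
  u @ \oo --> x -> weak_cvg u x.
Proof.
by move=> ux psi [_ psic]; apply: continuous_cvg => //; exact: psic.
Qed.

Lemma cst_weak_cvg {X : normedModType R} (x : X) : weak_cvg (fun=> x) x.
Proof. by move=> psi _; exact: cvg_cst. Qed.

Lemma weak_cvg_linear {X Y : normedModType R} (A : X -> Y) (u : nat -> X) (x : X) :
  (forall (a : R) (v w : X), A (a *: v + w) = a *: A v + A w) -> continuous A ->
  weak_cvg u x -> weak_cvg (A \o u) (A x).
Proof.
move=> Al Ac ux psi [psil psic]; apply: (ux (psi \o A)); split.
  by move=> a v w /=; rewrite Al psil.
by move=> v; apply: continuous_comp; [exact: Ac|exact: psic].
Qed.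

Lemma wslsc_open {X : normedModType R} (f : X -> R) (a : R) :
  wslsc f -> open [set x | a < f x].
Proof.
move=> fl; rewrite openE => x /= ax.
apply/not_notP => nx.
have /choice[u uP] : forall n, exists y, `|x - y| < n.+1%:R^-1 /\ f y <= a.
  move=> n; apply/not_notP => nn; apply: nx.
  apply/nbhs_ballP; exists n.+1%:R^-1 => /=; first by rewrite invr_gt0.
  move=> y; rewrite -ball_normE /= => xy; rewrite ltNge; apply/negP => fy.
  by apply: nn; exists y.
have ux : u @ \oo --> x.
  apply/cvgrPdist_lt => e e0; near=> n.
  apply: lt_trans (uP n).1 _.
  by near: n; exact: (near_infty_natSinv_lt (PosNum e0)).
have e0 : 0 < f x - a by rewrite subr_gt0.
have [n] := filter_ex (limn_einf_near _ _ _ (fl u x (cvg_weak_cvg u x ux)) e0).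
by rewrite subKr ltNge (uP n).2.
Unshelve. all: by end_near. Qed.

(** The open sets [F n] have empty intersection since [f] is finite, so by Baire some [F n] misses a
    ball. *)
Lemma wslsc_locally_bounded {X : completeNormedModType R} (f : X -> R) :
  wslsc f -> exists x0 r m, 0 < r /\ forall y, `|x0 - y| < r -> f y <= m.
Proof.
move=> fl; pose F (n : nat) := [set x | n%:R < f x].
have [n nF] : exists n, ~ dense (F n).
  apply/existsNP => Fd.
  have := @Baire R X F (fun n => conj (wslsc_open _ _ fl) (Fd n)).
  move=> /(_ setT) [||x [_ xF]]; [by exists 0|exact: openT|].
  have := xF (Num.bound `|f x|) I; rewrite /F /=; apply/negP; rewrite -leNgt.
  exact: le_trans (ler_norm _) (ltW (archi_boundP (normr_ge0 _))).
move/denseNE : nF => [G [[x xG] GF]].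
have /nbhs_ballP[r /= r0 rG] := open_nbhs_nbhs xG.
exists x, r, n%:R; split=> // y xy; rewrite leNgt; apply/negP => ny.
have : (G `&` F n) y by split=> //; apply: rG; rewrite -ball_normE.
by rewrite GF.
Qed.

Lemma convex_lower_bound {X : normedModType R} (h : X -> R) (x0 : X) (r m : R) :
  convex_fun h -> 0 < r -> (forall y, `|x0 - y| < r -> h y <= m) ->
  exists c : R, forall x, h 0 - c * `|x| <= h x.
Proof.
move=> hc r0 hm; pose B := (m + h (- x0)) / 2.
have hB z : `|z| < r / 2 -> h z <= B.
  move=> zr; have half : 0 <= (2^-1 : R) <= 1 by lra.
  have := hc (x0 + 2 *: z) (- x0) 2^-1 half.
  have -> : 2^-1 *: (x0 + 2 *: z) + (1 - 2^-1) *: - x0 = z.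
    have -> : (1 - 2^-1 : R) = 2^-1 by lra.
    by rewrite -scalerDr addrAC subrr add0r scalerA mulVf ?scale1r // pnatr_eq0.
  have : h (x0 + 2 *: z) <= m.
    apply: hm; rewrite opprD addNKr normrN normrZ ger0_norm //; lra.
  rewrite /B; lra.
pose s := r / 4; have s0 : 0 < s by rewrite divr_gt0.
exists ((B - h 0) / s) => x.
have [->|xn0] := eqVneq x 0; first by rewrite normr0 mulr0 subr0.
have nx : 0 < `|x| by rewrite normr_gt0.
have sx : 0 < s + `|x| by rewrite addr_gt0.
(* A point of norm [s] opposite to [x]: 0 lies on the segment from [x] to [z], so [h 0] and
   [h z <= B] bound [h x] from below. *)
pose z := - (s / `|x|) *: x.
have hz : h z <= B.
  apply: hB; rewrite /z normrZ normrN gtr0_norm ?divr_gt0 //.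
  by rewrite divfK ?gt_eqF // /s; lra.
pose t := s / (s + `|x|).
have t01 : 0 <= t <= 1.
  apply/andP; split; first by rewrite divr_ge0 // ltW.
  by rewrite ler_pdivrMr // mul1r lerDl ltW.
have := hc x z t t01.
have -> : t *: x + (1 - t) *: z = 0.
  rewrite /z scalerA -scalerDl [X in X *: _](_ : _ = 0) ?scale0r // /t.
  by field; rewrite !gt_eqF.
have -> : t * h x + (1 - t) * h z = (s * h x + `|x| * h z) / (s + `|x|).
  by rewrite /t; field; rewrite gt_eqF.
rewrite ler_pdivlMr // => h0.
have xz : `|x| * h z <= `|x| * B by rewrite ler_wpM2l // ltW.
rewrite -(ler_pM2l s0).
have -> : s * (h 0 - (B - h 0) / s * `|x|) = h 0 * (s + `|x|) - `|x| * B.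
  by field; rewrite gt_eqF.
lra.
Qed.

(** For [n > 1], bound [|a|] and [|b|] by their products with [n] and divide by [n]; the summand 1
    covers [n <= 1]. *)
Lemma quadratic_bound (a b c n mu : R) : 0 < mu -> 0 <= n ->
  a - c * n + mu / 2 * n ^+ 2 <= b ->
  n <= 1 + (`|a| + `|b| + `|c|) / (mu / 2).
Proof.
move=> mu0 n0 H; have mu20 : 0 < mu / 2 by rewrite divr_gt0.
set K := `|a| + `|b| + `|c|.
have K0 : 0 <= K by rewrite !addr_ge0.
have [n1|n1] := leP n 1; first by rewrite ler_wpDr // divr_ge0 // ltW.
suff : n <= K / (mu / 2) by lra.
have n_gt0 : 0 < n by lra.
rewrite ler_pdivlMr // mulrC -(ler_pM2r n_gt0) -mulrA -expr2.
have ca : c * n <= `|c| * n by rewrite ler_wpM2r // ler_norm.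
have an : `|a| <= `|a| * n by rewrite ler_peMr // ltW.
have bn : `|b| <= `|b| * n by rewrite ler_peMr // ltW.
have := ler_norm b; have := ler_norm (- a); rewrite normrN /K; lra.
Qed.

(* [h <= f], so the Baire bound for [f] also bounds the convex part [h] from
   above on a ball, which forces [h] to decrease at most linearly. *)
Lemma strongly_convex_coercive {X : completeNormedModType R} (f g : X -> R) (mu : R) :
  wslsc f -> strongly_convex mu g -> (forall x, g x <= f x) ->
  forall b : R, exists M : R, forall x, f x <= b -> `|x| <= M.
Proof.
move=> fl [mu0 gc] gf b.
have [x0 [r [m [r0 fm]]]] := wslsc_locally_bounded f fl.
pose h x := g x - mu / 2 * `|x| ^+ 2.
have [|c hcP] := @convex_lower_bound X h x0 r m gc r0.
  move=> y xy; apply: le_trans (fm y xy); apply: le_trans (gf y).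
  by rewrite /h lerBlDr lerDl mulr_ge0 ?sqr_ge0 // divr_ge0 // ltW.
exists (1 + (`|h 0| + `|b| + `|c|) / (mu / 2)) => x fb.
apply: quadratic_bound => //.
by have := hcP x; have := gf x; rewrite {2}/h; lra.
Qed.

Lemma wslsc_attains_min {X : normedModType R} (f : X -> R) :
  reflexive_space X ->
  (forall (u : nat -> X) x, weak_cvg u x ->
     forall e : R, 0 < e -> \forall n \near \oo, f x - e < f (u n)) ->
  (forall x, 0 <= f x) ->
  (forall b : R, exists M : R, forall x, f x <= b -> `|x| <= M) ->
  exists x, forall y, f x <= f y.
Proof.
move=> Xr fl f0 fc; pose I := inf (range f).
have fI : has_inf (range f) by split; [exists (f 0); exists 0|exists 0 => _ [x _ <-]].
have /choice[u uP] : forall n : nat, exists x, f x < I + n.+1%:R^-1.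
  move=> n; have n0 : 0 < n.+1%:R^-1 :> R by rewrite invr_gt0.
  by have [_ [x _ <-] xI] := inf_adherent n0 fI; exists x.
have [M MP] := fc (I + 1).
have uM n : `|u n| <= M.
  apply: MP; apply: le_trans (ltW (uP n)) _.
  by rewrite lerD2l invf_le1 // ler1n.
have [k [x [kj kx]]] := reflexive_weak_seq_compact Xr u M uM.
exists x => y; suff fxy (e : R) : 0 < e -> f x <= f y + e by exact/ler_addgt0Pr.
move=> e0.
have e20 : 0 < e / 2 by rewrite divr_gt0.
have Iy : I <= f y by apply: ge_inf; [exact: fI.2|exists y].
near \oo => j.
have xj : f x - e / 2 < f ((u \o k) j) by near: j; exact: fl.
have je : (j.+1%:R^-1 : R) < e / 2.
  by near: j; exact: (near_infty_natSinv_lt (PosNum e20)).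
(* By [j <= k j], the subsequence is still minimising. *)
have kje : ((k j).+1%:R^-1 : R) <= j.+1%:R^-1.
  by rewrite lef_pV2 ?posrE // ler_nat ltnS.
apply/ltW/(lt_le_trans (_ : f x < I + e)); last by rewrite lerD2r.
rewrite -ltrBlDr; apply: (@lt_trans _ _ (f (u (k j)) - e / 2)); first by move: xj => /=; lra.
rewrite ltrBlDr; apply: lt_le_trans (uP (k j)) _; rewrite lerD2l.
exact: le_trans kje (ltW je).
Unshelve. all: by end_near. Qed.

Lemma min_critical_point {X : normedModType R} (f : X -> R) (x : X) :
  (forall y, f x <= f y) -> critical_point f x.
Proof.
move=> fx; split.
  by split=> [a u v|]; [rewrite mulr0 addr0|exact: cst_continuous].
move=> e e0; apply: nearW => y; rewrite addr0.
by apply: le_trans (fx y); rewrite lerBlDr lerDl mulr_ge0 // ltW.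
Qed.

End LowerSemicontinuity.

Theorem mainTheorem2 (R : realType)
  (X Y : completeNormedModType R)
  (A : X -> Y) (Rg Rwc Rsc : X -> R) (D : Y -> Y -> R)
  (gamma mu C p : R)
  (A_lin : forall (a : R) (u v : X), A (a *: u + v) = a *: A u + A v)
  (A_cont : continuous A)
  (Rg_nonneg : forall x, 0 <= Rg x)
  (D_nonneg : forall y1 y2, 0 <= D y1 y2)
  (H1 : reflexive_space X)
  (H2 : wslsc Rg)
  (H3_split : forall x, Rg x = Rwc x + Rsc x)
  (H3_wc_nonneg : forall x, 0 <= Rwc x)
  (H3_wc : weakly_convex gamma Rwc)
  (H3_sc : strongly_convex mu Rsc)
  (H3_case : gamma <= mu \/
             (mu < gamma < 2 * mu /\ wslsc (fun x => Rsc x - mu / 2 * `|x| ^+ 2)))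
  (H4_lsc : wslsc2 D)
  (H4_conv : forall y2, convex_fun (fun y1 => D y1 y2))
  (H4_cont : forall y1, continuous (D y1))
  (H4_zero : forall y1 y2, D y1 y2 = 0 <-> y1 = y2)
  (H5_C : 0 < C) (H5_p : 1 <= p)
  (H5 : forall y1 y2 y3, D y1 y2 <= C * (D y1 y3 + `|y2 - y3| `^ p)) :
  forall (alpha : R) (ydelta : Y), 0 < alpha ->
    exists x : X, critical_point (fun x' => alpha * Rg x' + D (A x') ydelta) x.
Proof.
move=> alpha ydelta alpha0.
pose J x := alpha * Rg x + D (A x) ydelta.
suff [x xmin] : exists x, forall y, J x <= J y.
  by exists x; exact: min_critical_point.
have RgJ x : alpha * Rg x <= J x by rewrite lerDl.
apply: wslsc_attains_min => //.
- move=> u x ux e e0.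
  (* Scaled by [alpha], this tolerance for [Rg] becomes [e / 2]; the data term takes the other
     half. *)
  have e1 : 0 < e / 2 / alpha by rewrite !divr_gt0.
  have e2 : 0 < e / 2 by rewrite divr_gt0.
  have Du := H4_lsc _ _ _ _ (weak_cvg_linear A u x A_lin A_cont ux)
    (cst_weak_cvg ydelta).
  apply: filterS2 (limn_einf_near _ _ _ (H2 u x ux) e1)
    (limn_einf_near _ _ _ Du e2) => n.
  rewrite -(ltr_pM2l alpha0) mulrBr [alpha * (_ / _)]mulrC divfK ?gt_eqF // /J /=.
  lra.
- by move=> x; rewrite addr_ge0 // mulr_ge0 // ltW.
- move=> b; have [|M MP] := strongly_convex_coercive Rg Rsc mu H2 H3_sc _ (b / alpha).
    by move=> x; rewrite H3_split lerDr.
  exists M => x Jb; apply: MP; rewrite ler_pdivlMr // mulrC.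
  exact: le_trans (RgJ x) Jb.
Qed.
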